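(* Let $g$ and $\kappa$ be non-negative integers and let $\phi_2 := \phi|_{\mathcal{G}_\kappa(g,2)}$ be the restriction of $\phi$ to $\mathcal{G}_\kappa(g,2)$. Then $\operatorname{Im}(\phi_2) \subseteq \mathcal{G}_{\kappa+1}(g+1,2)$.
   Context: $\mathbb{N}$ denotes the positive integers. A gapset is a finite set $G \subset \mathbb{N}$ such that whenever $z \in G$ and $z = x+y$ with $x,y \in \mathbb{N}$, then $x \in G$ or $y \in G$. The genus of $G$ is its cardinality $g$; we write $G = \{\ell_1 < \ell_2 < \cdots < \ell_g\}$. The multiplicity is $m(G) := \min\{s \in \mathbb{N} : s \notin G\}$; the conductor $c(G)$ is the least $s$ such that $s+n \notin G$ for all integers $n \geq 0$ (so $c(G) = \ell_g+1$ for $G \ne \emptyset$, and $c(\emptyset)=0$); the depth is $q(G) := \lceil c(G)/m(G) \rceil$. For $g \geq 2$, $G$ is pure $\kappa$-sparse if $\ell_{i+1}-\ell_i \leq \kappa$ for all $i \in \{1,\dots,g-1\}$ and $\ell_{i+1}-\ell_i = \kappa$ for some $i$. By convention, $\emptyset$ is pure $0$-sparse and $\{1\}$ is pure $1$-sparse (and for no other value of the parameter). $\mathcal{G}_\kappa(g)$ denotes the set of all pure $\kappa$-sparse gapsets of genus $g$, and $\mathcal{G}_\kappa(g,q) := \{G \in \mathcal{G}_\kappa(g) : q(G) = q\}$. The map $\phi$: for $G = \{\ell_1 < \cdots < \ell_g\} \in \mathcal{G}_\kappa(g)$ with $g \geq 2$, let $\alpha := \max\{i : \ell_{i+1}-\ell_i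 = \kappa\}$ and $$\phi(G) := \{1\} \cup \{\ell_i + 1 : 1 \leq i \leq \alpha\} \cup \{\ell_i + 2 : \alpha+1 \leq i \leq g\}.$$ By convention $\phi(\emptyset) = \{1\}$ and $\phi(\{1\}) = \{1,3\}$. *)

(* Defs.v *)
From mathcomp Require Import all_boot all_order all_algebra finmap.
From mathcomp Require Import boolp classical_sets.

Set Implicit Arguments.
Unset Strict Implicit.
Unset Printing Implicit Defensive.

Import Order.TTheory GRing.Theory Num.Theory.

Local Open Scope fset_scope.
Local Open Scope nat_scope.

(* The condition 0 \notin G expresses that G consists of positive integers. *)
Definition is_gapset (G : {fset nat}) : Prop :=
  0 \notin G /\
  forall x y : nat, 0 < x -> 0 < y -> x + y \in G -> x \in G \/ y \in G.

Definition genus (G : {fset nat}) : nat := #|` G|.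

(* ell G i is the i-th smallest element of G, indexed from 1 to genus G. *)
Definition ell (G : {fset nat}) (i : nat) : nat :=
  nth 0 (sort leq G) i.-1.

Lemma notin_large (G : {fset nat}) (s : nat) :
  \max_(x <- G) x < s -> s \notin G.
Proof.
by apply: contraTN => sG; rewrite -leqNgt; apply: (leq_bigmax_seq (F := id)).
Qed.

Lemma multiplicity_ex (G : {fset nat}) :
  exists s : nat, (0 < s) && (s \notin G).
Proof. by exists (\max_(x <- G) x).+1; rewrite /= notin_large. Qed.

Definition multiplicity (G : {fset nat}) : nat := ex_minn (multiplicity_ex G).

Lemma conductor_ex (G : {fset nat}) :
  exists s : nat, `[< forall n : nat, s + n \notin G >].
Proof.
exists (\max_(x <- G) x).+1; apply/asboolP => n.
by apply: notin_large; rewrite addSn ltnS leq_addr.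
Qed.

Definition conductor (G : {fset nat}) : nat := ex_minn (conductor_ex G).

Definition depth (G : {fset nat}) : int :=
  Num.ceil ((conductor G)%:R / (multiplicity G)%:R : rat)%R.

(* A singleton gapset is necessarily {1}. The truncated subtraction is exact
   because ell G is increasing on the range considered. *)
Definition pure_sparse (kappa : nat) (G : {fset nat}) : Prop :=
  if G == fset0 then kappa = 0
  else if G == [fset 1] then kappa = 1
  else (forall i : nat, 1 <= i <= (genus G).-1 ->
          ell G i.+1 - ell G i <= kappa) /\
       (exists i : nat, 1 <= i <= (genus G).-1 /\
          ell G i.+1 - ell G i = kappa).

Definition sparse_gapsets (kappa g : nat) : set {fset nat} :=
  [set G | [/\ is_gapset G, genus G = g & pure_sparse kappa G]]%classic.

Definition sparse_gapsets_depth (kappa g q : nat) : set {fset nat} :=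
  [set G | sparse_gapsets kappa g G /\ depth G = q%:Z%R]%classic.

Definition alpha (kappa : nat) (G : {fset nat}) : nat :=
  \max_(1 <= i < genus G | ell G i.+1 - ell G i == kappa) i.

(* phi acts on pure kappa-sparse gapsets; kappa is determined by G there, and
   is passed explicitly. *)
Definition phi (kappa : nat) (G : {fset nat}) : {fset nat} :=
  if G == fset0 then [fset 1]
  else if G == [fset 1] then [fset 1; 3]
  else let a := alpha kappa G in
    1 |` ([fset ell G i + 1 | i in index_iota 1 a.+1] `|`
          [fset ell G i + 2 | i in index_iota a.+1 (genus G).+1]).

(* Main.v *)
(** Write m for the multiplicity of G. Depth 2 means m < c(G) <= 2m, that is,
    {1, .., m-1} is contained in G, G lies below 2m, and some element of G
    exceeds m; any finite set of positive integers of this shape is a gapset.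
    The element of G after m-1 is at least m+1, so kappa >= 2 and the last gap
    of length kappa ends above m. Hence [phi] shifts 1, .., m-1 by one only, so
    that phi(G) has multiplicity m+1, and its maximum is at most
    (2m-1) + 2 = 2(m+1) - 1. The gaps of phi(G) are a new gap 1, and those of
    G with the last gap of length kappa lengthened by one. *)
Require Import Defs.
From mathcomp Require Import all_boot all_order all_algebra finmap.
From mathcomp Require Import boolp classical_sets.
From mathcomp Require Import zify.

Set Implicit Arguments.
Unset Strict Implicit.
Unset Printing Implicit Defensive.

Import Order.TTheory GRing.Theory Num.Theory.

Local Open Scope fset_scope.
Local Open Scope nat_scope.

(** * Multiplicity, conductor, and gapsets of depth two *)

Lemma multiplicity_gt0 (G : {fset nat}) : 0 < multiplicity G.
Proof. by rewrite /multiplicity; case: ex_minnP => m /andP[]. Qed.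

Lemma multiplicity_notin (G : {fset nat}) : multiplicity G \notin G.
Proof. by rewrite /multiplicity; case: ex_minnP => m /andP[]. Qed.

Lemma lt_multiplicity_in (G : {fset nat}) (x : nat) :
  0 < x < multiplicity G -> x \in G.
Proof.
rewrite /multiplicity; case: ex_minnP => m _ min_m /andP[x_gt0 x_lt].
by apply: contraTT x_lt => xG; rewrite -leqNgt min_m // x_gt0.
Qed.

Lemma multiplicity_eq (G : {fset nat}) (m : nat) :
  0 < m -> m \notin G -> (forall x, 0 < x < m -> x \in G) ->
  multiplicity G = m.
Proof.
move=> m_gt0 mG ltmG; rewrite /multiplicity; case: ex_minnP => k.
case/andP=> k_gt0 kG min_k; apply/eqP; rewrite eqn_leq min_k ?m_gt0 //=.
by rewrite leqNgt; apply: contra kG => km; rewrite ltmG // k_gt0.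
Qed.

Lemma in_lt_conductor (G : {fset nat}) (x : nat) : x \in G -> x < conductor G.
Proof.
rewrite /conductor; case: ex_minnP => c /asboolP cP _ xG.
rewrite ltnNge; apply/negP => cx.
by have := cP (x - c); rewrite subnKC // xG.
Qed.

Lemma conductor_leP (G : {fset nat}) (n : nat) :
  reflect (forall x, x \in G -> x < n) (conductor G <= n).
Proof.
apply: (iffP idP) => [cn x /in_lt_conductor xc|ltGn]; first exact: leq_trans cn.
rewrite /conductor; case: ex_minnP => c _; apply; apply/asboolP => k.
by apply/negP => /ltGn; rewrite ltnNge leq_addr.
Qed.

Lemma conductor_gtP (G : {fset nat}) (n : nat) :
  reflect (exists2 x, x \in G & n <= x) (n < conductor G).
Proof.
rewrite ltnNge; apply: (iffP idP) => [|[x xG nx]]; last first.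
  by apply/conductor_leP => /(_ x xG); rewrite ltnNge nx.
apply: contraNP => noG; apply/conductor_leP => x xG.
by rewrite ltnNge; apply/negP => nx; apply: noG; exists x.
Qed.

(** A ceiling equals 2 exactly when its argument lies in the interval from 1 (excluded) to 2
    (included); the positive denominator is then cleared. *)
Lemma depth_eq2 (G : {fset nat}) :
  (depth G == 2%:Z%R) =
  (multiplicity G < conductor G <= (multiplicity G).*2).
Proof.
have m_gt0 : (0 < (multiplicity G)%:R :> rat)%R.
  by rewrite ltr0n multiplicity_gt0.
rewrite /depth ceil_eq ltr_pdivlMr // ler_pdivrMr // mul1r ltr_nat.
by rewrite -pmulrn -natrM ler_nat mul2n.
Qed.

(** A sum below twice the multiplicity has a summand below the multiplicity, and such a summand lies
    in [G]. *)
Lemma depth2_gapset (G : {fset nat}) :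
  0 \notin G -> depth G = 2%:Z%R -> is_gapset G.
Proof.
move=> G0 /eqP; rewrite depth_eq2 => /andP[_ /conductor_leP ltG].
split=> // x y x_gt0 y_gt0 /ltG xy_lt.
by have [xm|xm] := ltnP x (multiplicity G);
  [left|right]; apply: lt_multiplicity_in; lia.
Qed.

(** * The increasing enumeration of a finite set *)

Lemma sort_fset_ltn_sorted (G : {fset nat}) : sorted ltn (sort leq G).
Proof.
by rewrite ltn_sorted_uniq_leq sort_uniq fset_uniq sort_sorted //.
Qed.

Lemma ell_in (G : {fset nat}) (i : nat) : 1 <= i <= genus G -> ell G i \in G.
Proof.
rewrite /genus => iP; rewrite -[_ \in G](mem_sort leq) mem_nth // size_sort.
by case: i iP.
Qed.

Lemma in_ell (G : {fset nat}) (x : nat) :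
  x \in G -> exists2 i, 1 <= i <= genus G & x = ell G i.
Proof.
rewrite -[_ \in G](mem_sort leq) => /(nthP 0)[i]; rewrite size_sort => iP <-.
by exists i.+1.
Qed.

Lemma ltn_ell (G : {fset nat}) (i j : nat) :
  1 <= i -> i < j -> j <= genus G -> ell G i < ell G j.
Proof.
case: i j => [|i] [|j] // _ ij jg.
apply: (sorted_ltn_nth ltn_trans 0 (sort_fset_ltn_sorted G)) => //;
  rewrite inE size_sort //; exact: ltn_trans jg.
Qed.

Lemma leq_ell (G : {fset nat}) (i j : nat) :
  1 <= i -> i <= j -> j <= genus G -> ell G i <= ell G j.
Proof.
move=> i1; rewrite leq_eqVlt => /predU1P[->//|ij jg].
exact/ltnW/ltn_ell.
Qed.

(** Two strictly sorted lists with the same members coincide. This serves to read off genus and gaps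
    of [phi kappa G] from an explicit formula. *)
Lemma ell_unique (G : {fset nat}) (n : nat) (f : nat -> nat) :
  (forall i j, 1 <= i -> i < j -> j <= n -> f i < f j) ->
  (forall x, x \in G <-> exists2 i, 1 <= i <= n & x = f i) ->
  genus G = n /\ (forall i, 1 <= i <= n -> ell G i = f i).
Proof.
move=> fmono fG.
have sortE : sort leq G = [seq f i | i <- iota 1 n].
  apply: (irr_sorted_eq ltn_trans ltnn (sort_fset_ltn_sorted G)).
    apply: (homo_sorted_in (P := [pred i | 1 <= i <= n])) (iota_ltn_sorted 1 n).
      by move=> i j; rewrite !inE => /andP[i1 _] /andP[_ jn] ij; apply: fmono.
    by apply/allP => i; rewrite mem_iota inE; lia.
  move=> x; rewrite mem_sort; apply/idP/mapP => [/fG[i iP ->]|[i iP ->]].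
    by exists i => //; rewrite mem_iota; lia.
  by apply/fG; exists i => //; move: iP; rewrite mem_iota; lia.
split; first by rewrite /genus -(size_sort leq) sortE size_map size_iota.
move=> i iP; rewrite /ell sortE (nth_map 0) ?size_iota ?nth_iota; try lia.
by congr f; lia.
Qed.

(** * Gaps of maximal length and the enumeration of the image *)

Lemma pure_sparseE (kappa : nat) (G : {fset nat}) : 1 < genus G ->
  pure_sparse kappa G <->
  (forall i, 1 <= i < genus G -> ell G i.+1 - ell G i <= kappa) /\
  (exists2 i, 1 <= i < genus G & ell G i.+1 - ell G i = kappa).
Proof.
move=> g1; rewrite /pure_sparse.
case: eqP => [G0|_]; first by move: g1; rewrite /genus G0 cardfs0.
case: eqP => [G1|_]; first by move: g1; rewrite /genus G1 cardfs1.
have gE i : (1 <= i <= (genus G).-1) = (1 <= i < genus G) by lia.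
split=> [[gap_le [i [iP gap_i]]]|[gap_le [i iP gap_i]]].
- split; last by exists i; rewrite -?gE.
  by move=> j jP; apply: gap_le; rewrite gE.
- split; last by exists i; rewrite gE.
  by move=> j; rewrite gE; apply: gap_le.
Qed.

Lemma alpha_max (kappa : nat) (G : {fset nat}) (i : nat) :
  1 <= i < genus G -> ell G i.+1 - ell G i = kappa -> i <= alpha kappa G.
Proof.
move=> iP /eqP gap_i.
by apply: (leq_bigmax_seq (F := id)) => //; rewrite mem_index_iota.
Qed.

Lemma alphaP (kappa : nat) (G : {fset nat}) :
  1 < genus G -> pure_sparse kappa G ->
  1 <= alpha kappa G < genus G /\
  ell G (alpha kappa G).+1 - ell G (alpha kappa G) = kappa.
Proof.
move=> g1 /(pure_sparseE _ g1)[_ [i iP gap_i]].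
have := alpha_max iP gap_i.
(* A maximum over indices is either attained or the default 0; the latter is excluded by the index
   [i >= 1] of a gap of length [kappa]. *)
suff [-> | //] : alpha kappa G = 0 \/
    (1 <= alpha kappa G < genus G /\
     ell G (alpha kappa G).+1 - ell G (alpha kappa G) = kappa).
  by lia.
rewrite /alpha big_seq_cond; elim/big_ind: _ => [|x y Px Py|j]; first by left.
  by rewrite /maxn; case: ifP.
by rewrite mem_index_iota => /andP[jP /eqP]; right.
Qed.

(** The candidate for the [i]-th element of [phi kappa G], for [i] from 1 to [genus G + 1]. The new
    element 1 comes first, so the index into [G] drops by one. *)
Definition phi_ell (kappa : nat) (G : {fset nat}) (i : nat) : nat :=
  if i <= 1 then 1 else ell G i.-1 + (if i.-1 <= alpha kappa G then 1 else 2).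

Lemma ell_gt0 (G : {fset nat}) (i : nat) :
  0 \notin G -> 1 <= i <= genus G -> 0 < ell G i.
Proof.
move=> G0 iP; rewrite lt0n; apply: contraNneq G0 => <-; exact: ell_in.
Qed.

Lemma in_phi (kappa : nat) (G : {fset nat}) (x : nat) :
  1 < genus G -> alpha kappa G < genus G ->
  x \in phi kappa G <->
  exists2 i, 1 <= i <= (genus G).+1 & x = phi_ell kappa G i.
Proof.
move=> g1 ag; rewrite /phi.
case: eqP => [G0|_]; first by move: g1; rewrite /genus G0 cardfs0.
case: eqP => [G1|_]; first by move: g1; rewrite /genus G1 cardfs1.
split.
  rewrite !inE => /or3P[/eqP-> | /imfsetP[i /= iP ->] | /imfsetP[i /= iP ->]].
  - by exists 1.
  - move: iP; rewrite mem_index_iota => iP.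
    by exists i.+1; [lia | rewrite /phi_ell /=; repeat case: ifP; lia].
  - move: iP; rewrite mem_index_iota => iP.
    by exists i.+1; [lia | rewrite /phi_ell /=; repeat case: ifP; lia].
case=> i iP ->; rewrite /phi_ell; case: ifPn => i1; first by rewrite !inE.
rewrite !inE; apply/orP; right; apply/orP; case: ifPn => ia; [left|right].
  by apply/imfsetP; exists i.-1 => //=; rewrite mem_index_iota; lia.
by apply/imfsetP; exists i.-1 => //=; rewrite mem_index_iota; lia.
Qed.

(** The shift only grows along the enumeration, from 1 to 2, and shifted positive elements exceed
    the new element 1. *)
Lemma ltn_phi_ell (kappa : nat) (G : {fset nat}) (i j : nat) :
  0 \notin G -> 1 <= i -> i < j -> j <= (genus G).+1 ->
  phi_ell kappa G i < phi_ell kappa G j.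
Proof.
move=> G0 i1 ij jg; rewrite /phi_ell.
have := @ltn_ell G i.-1 j.-1; have := @ell_gt0 G j.-1 G0.
by repeat case: ifP; lia.
Qed.

Lemma ell_phi (kappa : nat) (G : {fset nat}) :
  0 \notin G -> 1 < genus G -> alpha kappa G < genus G ->
  genus (phi kappa G) = (genus G).+1 /\
  (forall i, 1 <= i <= (genus G).+1 ->
     ell (phi kappa G) i = phi_ell kappa G i).
Proof.
move=> G0 g1 ag; apply: ell_unique => [i j|x]; last exact: in_phi.
exact: ltn_phi_ell.
Qed.

Lemma phi_pure_sparse (kappa : nat) (G : {fset nat}) :
  0 \notin G -> 1 \in G -> 1 < genus G -> pure_sparse kappa G ->
  pure_sparse kappa.+1 (phi kappa G).
Proof.
move=> G0 /in_ell[k kP ellk] g1 pureG; have [aP gap_a] := alphaP g1 pureG.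
have ag : alpha kappa G < genus G by case/andP: aP.
have [gphi ellphi] := ell_phi G0 g1 ag.
have /(pure_sparseE _ g1)[gap_le _] := pureG.
apply/pure_sparseE; rewrite gphi; first by lia.
split=> [i iP|].
  rewrite !ellphi; try lia.
  case: i iP => [|[|i]] // iP; rewrite /phi_ell /=.
    (* The new first gap: the least element of [G] is at most 1 and is shifted by one, as
       [alpha kappa G >= 1]. *)
    by have := @leq_ell G 1 k; case: ifP; lia.
  have := gap_le i.+1; have := @alpha_max kappa G i.+1.
  by case: ifP; case: ifP; lia.
(* The ends of the last gap of length [kappa] are shifted by 1 and 2 respectively, and its index
   goes up by one. *)
exists (alpha kappa G).+1; first by lia.
rewrite !ellphi; try lia.
have := @ltn_ell G (alpha kappa G) (alpha kappa G).+1.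
by rewrite /phi_ell /=; repeat case: ifP; lia.
Qed.

(** * Consequences of depth two *)

(** For multiplicity 1, an element [x] with [1 <= x < 2] would be the multiplicity itself. *)
Lemma depth2_mult_gt1 (G : {fset nat}) :
  0 \notin G -> depth G = 2%:Z%R -> 1 < multiplicity G.
Proof.
move=> G0 /eqP; rewrite depth_eq2 => /andP[/conductor_gtP[x xG mx]].
move=> /conductor_leP/(_ x xG) x_lt; have := multiplicity_gt0 G.
rewrite leq_eqVlt => /predU1P[m1|//]; have := multiplicity_notin G.
by rewrite -m1 (_ : 1 = x) ?xG //; lia.
Qed.

(** The element 1 differs from any element at or above the multiplicity. *)
Lemma depth2_genus_gt1 (G : {fset nat}) :
  0 \notin G -> depth G = 2%:Z%R -> 1 < genus G.
Proof.
move=> G0 dG; have m1 := depth2_mult_gt1 G0 dG.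
have /in_ell[i iP elli] : 1 \in G by apply: lt_multiplicity_in.
move/eqP: dG; rewrite depth_eq2 => /andP[/conductor_gtP[x /in_ell[j jP ->]]].
move=> mj _; rewrite ltnNge; apply/negP => g1.
by have ij : i = j; [lia | move: mj; rewrite -ij -elli; lia].
Qed.

(** With gaps of length at most 1, the enumeration starts at 1 and can never jump over the
    multiplicity, so no element would exceed it. *)
Lemma pure_sparse_ge2 (kappa : nat) (G : {fset nat}) :
  0 \notin G -> depth G = 2%:Z%R -> pure_sparse kappa G -> 1 < kappa.
Proof.
move=> G0 dG; have g1 := depth2_genus_gt1 G0 dG.
have m1 := depth2_mult_gt1 G0 dG.
move=> /(pure_sparseE _ g1)[gap_le _]; rewrite ltnNge; apply/negP => k1.
have /in_ell[k kP ellk] : 1 \in G by apply: lt_multiplicity_in.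
have ltm i : 1 <= i <= genus G -> ell G i < multiplicity G.
  elim: i => [|[|i] IHi] // iP; first by have := @leq_ell G 1 k; lia.
  have := gap_le i.+1; have := IHi; have : ell G i.+2 != multiplicity G.
    by apply: contraNneq (multiplicity_notin G) => <-; apply: ell_in.
  by lia.
move/eqP: dG; rewrite depth_eq2 => /andP[/conductor_gtP[x /in_ell[j jP ->]]].
by rewrite leqNgt ltm.
Qed.

(** Otherwise the last gap of length [kappa >= 2] would end below the multiplicity, where [G] has no
    holes: the successor of its lower end would lie in [G], strictly inside the gap. *)
Lemma mult_le_ell_after_alpha (kappa : nat) (G : {fset nat}) (i : nat) :
  0 \notin G -> depth G = 2%:Z%R -> pure_sparse kappa G ->
  alpha kappa G < i <= genus G -> multiplicity G <= ell G i.
Proof.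
move=> G0 dG pureG iP; have g1 := depth2_genus_gt1 G0 dG.
have k2 := pure_sparse_ge2 G0 dG pureG.
have [] := alphaP g1 pureG; set a := alpha kappa G in iP * => aP gap_a.
rewrite leqNgt; apply/negP => i_lt.
have lt_a : ell G a < ell G a.+1 by apply: ltn_ell; lia.
have le_i : ell G a.+1 <= ell G i by apply: leq_ell; lia.
have /in_ell[j jP ellj] : (ell G a).+1 \in G by apply: lt_multiplicity_in; lia.
have aj : a < j.
  by rewrite ltnNge; apply/negP => ja; have := @leq_ell G j a; lia.
by have := @leq_ell G a.+1 j; lia.
Qed.

(** * Multiplicity and depth of the image *)

Lemma phi_notin0 (kappa : nat) (G : {fset nat}) :
  1 < genus G -> alpha kappa G < genus G -> 0 \notin phi kappa G.
Proof.
move=> g1 ag; apply/negP => /(in_phi _ g1 ag)[i _].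
by rewrite /phi_ell; repeat case: ifP; lia.
Qed.

Lemma phi_multiplicity (kappa : nat) (G : {fset nat}) :
  0 \notin G -> depth G = 2%:Z%R -> pure_sparse kappa G ->
  multiplicity (phi kappa G) = (multiplicity G).+1.
Proof.
move=> G0 dG pureG; have g1 := depth2_genus_gt1 G0 dG.
have m1 := depth2_mult_gt1 G0 dG.
have [/andP[a1 ag] _] := alphaP g1 pureG.
have after_a := mult_le_ell_after_alpha G0 dG pureG.
apply: multiplicity_eq => // [|x xP].
  (* Elements shifted by two are at least [multiplicity G + 2], and one shifted by one onto
     [multiplicity G + 1] would come from the multiplicity itself. *)
  apply/negP => /(in_phi _ g1 ag)[i iP]; rewrite /phi_ell.
  case: ifPn => i1; first by lia.
  case: ifPn => ia; last by have := after_a i.-1; lia.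
  rewrite addn1 => -[mE]; have := multiplicity_notin G.
  by rewrite mE ell_in //; lia.
apply/(in_phi _ g1 ag); have [x1|x1] := leqP x 1.
  by exists 1; rewrite // /phi_ell /=; lia.
(* Being below the multiplicity, [x.-1] has index at most [alpha kappa G], hence is shifted by one
   onto [x]. *)
have /in_ell[i iP elli] : x.-1 \in G by apply: lt_multiplicity_in; lia.
exists i.+1; first by lia.
by rewrite /phi_ell /=; have := after_a i; repeat case: ifP; lia.
Qed.

Lemma phi_depth2 (kappa : nat) (G : {fset nat}) :
  0 \notin G -> depth G = 2%:Z%R -> pure_sparse kappa G ->
  depth (phi kappa G) = 2%:Z%R.
Proof.
move=> G0 dG pureG; have g1 := depth2_genus_gt1 G0 dG.
have [/andP[a1 ag] _] := alphaP g1 pureG.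
apply/eqP; rewrite depth_eq2 phi_multiplicity //.
move/eqP: dG; rewrite depth_eq2.
case/andP=> /conductor_gtP[x xG mx] /conductor_leP ltG.
apply/andP; split.
  have [i iP elli] := in_ell xG; have x_neq : x != multiplicity G.
    by apply: contraTneq xG => ->; apply: multiplicity_notin.
  (* The image of [x] is at least [x + 1], so it reaches the new multiplicity. *)
  apply/conductor_gtP; exists (phi_ell kappa G i.+1).
    by apply/(in_phi _ g1 ag); exists i.+1 => //; lia.
  by rewrite /phi_ell /=; repeat case: ifP; lia.
apply/conductor_leP => y /(in_phi _ g1 ag)[i iP ->]; rewrite /phi_ell.
case: ifPn => i1; first by lia.
by have := ltG _ (@ell_in G i.-1 _); case: ifP; lia.
Qed.

Theorem theorem4p5 (g kappa : nat) :
  ([set phi kappa G | G in sparse_gapsets_depth kappa g 2]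
     `<=` sparse_gapsets_depth kappa.+1 g.+1 2)%classic.
Proof.
move=> _ [G [[[G0 _] genusG pureG] dG] <-].
(* Genus at least 2 excludes the conventional cases in the definitions of [phi] and
   [pure_sparse]. *)
have g1 := depth2_genus_gt1 G0 dG; have m1 := depth2_mult_gt1 G0 dG.
have [/andP[_ ag] _] := alphaP g1 pureG.
have dphi := phi_depth2 G0 dG pureG.
split=> //; split.
- by apply: depth2_gapset => //; apply: phi_notin0.
- by rewrite (ell_phi G0 g1 ag).1 genusG.
- by apply: phi_pure_sparse => //; apply: lt_multiplicity_in.
Qed.
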